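(* If $(G,\tau)$ is a sequential Hausdorff topological group, then it is an $s$-group. More precisely, $\tau=\tau_{S(G,\tau)}=\bigwedge_{\mathbf{u}\in S(G,\tau)}\tau_{\mathbf{u}}$.
   Context: A topological space is sequential if a subset $A$ is open exactly when it is sequentially open, i.e. whenever a sequence converges to a point of $A$, all but finitely many of its members lie in $A$. A set $S$ of sequences in a group $G$ is a $T_s$-set of sequences if there is a Hausdorff group topology on $G$ in which all sequences of $S$ converge to the unit $e_G$; then $\tau_S$ denotes the finest Hausdorff group topology on $G$ with this property. For a single sequence $\mathbf{u}$ with $\{\mathbf{u}\}$ a $T_s$-set (a $T$-sequence), $\tau_{\mathbf{u}}$ denotes the finest Hausdorff group topology in which $\mathbf{u}$ converges to $e_G$. A Hausdorff topological group $(G,\tau)$ is an $s$-group if $\tau=\tau_S$ for some $T_s$-set $S$ of sequences in $G$. For a Hausdorff topological group $(G,\tau)$, $S(G,\tau)$ is the set of all sequences in $G$ converging to $e_G$ in $\tau$. $\bigwedge_{\mathbf{u}\in S}\tau_{\mathbf{u}}$ denotes the intersection of the topologies: a set $U$ is open in it if and only if $U\in\tau_{\mathbf{u}}$ for every $\mathbf{u}\in S$. *)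

(* Defs.v *)
From HB Require Import structures.
From mathcomp Require Import all_boot all_order all_algebra.
From mathcomp Require Import all_classical.
From mathcomp Require Import topology.

Set Implicit Arguments.
Unset Strict Implicit.
Unset Printing Implicit Defensive.

Local Open Scope classical_set_scope.

(* Several topologies on the same carrier have to be compared, so a topology is
   a value rather than a structure inferred from the type. *)
Record topology (T : Type) := Topology {
  opens : set_system T;
  opensT : opens setT;
  opensI : setI_closed opens;
  opens_bigU : forall (I : Type) (f : I -> set T),
    (forall i, opens (f i)) -> opens (\bigcup_i f i)
}.

Lemma topology_eq (T : Type) (s t : topology T) : opens s = opens t -> s = t.
Proof.
case: s t => [o p q r] [o' p' q' r'] /= e.
by case: _ / e p' q' r' => p' q' r'; congr Topology; exact: Prop_irrelevance.
Qed.

HB.instance Definition _ (T : Type) := gen_eqMixin (topology T).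
HB.instance Definition _ (T : Type) := gen_choiceMixin (topology T).

Definition finer (T : Type) (s t : topology T) := opens t `<=` opens s.

Definition discrete (T : Type) : topology T :=
  @Topology T setT I (fun _ _ _ _ => I) (fun _ _ _ => I).

Section meet_topology.
Variables (T J : Type) (D : set J) (t : J -> topology T).

Let meet_opens : set_system T := \bigcap_(j in D) opens (t j).

Fact meet_opensT : meet_opens setT.
Proof. by move=> j _; exact: opensT. Qed.

Fact meet_opensI : setI_closed meet_opens.
Proof.
by move=> A B oA oB j Dj; apply: opensI; [exact: oA|exact: oB].
Qed.

Fact meet_opens_bigU (K : Type) (f : K -> set T) :
  (forall k, meet_opens (f k)) -> meet_opens (\bigcup_k f k).
Proof. by move=> of_ j Dj; apply: opens_bigU => k; exact: of_. Qed.

Definition meet_topology : topology T :=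
  Topology meet_opensT meet_opensI meet_opens_bigU.

End meet_topology.

(* [space t] is a copy of T that carries the topology t, which gives access to
   the library's notions of convergence, continuity and separation for t. *)
Definition space (T : Type) (t : topology T) : Type := T.

HB.instance Definition _ (T : choiceType) (t : topology T) :=
  Choice.on (space t).
HB.instance Definition _ (T : choiceType) (t : topology T) :=
  isOpenTopological.Build (space t) (@opensT _ t) (@opensI _ t)
    (@opens_bigU _ t).

Lemma open_space (T : choiceType) (t : topology T) :
  (open : set_system (space t)) = opens t.
Proof. by []. Qed.

Definition sequentially_open (X : topologicalType) (A : set X) :=
  forall (u : nat -> X) (x : X),
    A x -> u @ \oo --> x -> \forall n \near \oo, A (u n).

Definition sequential_space (X : topologicalType) :=
  forall A : set X, open A <-> sequentially_open A.

Section topologies_on_groups.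
Variable G : groupType.
Implicit Types (t : topology G) (u : nat -> G) (S : set (nat -> G)).

Definition group_topology t :=
  continuous (fun p : space t * space t => (p.1 * p.2)%g : space t) /\
  continuous (fun x : space t => (x^-1)%g : space t).

Definition hausdorff_group_topology t :=
  group_topology t /\ hausdorff_space (space t).

Definition convergent_to_unit t : set (nat -> G) :=
  [set u | u @ \oo --> (1%g : space t)].

Definition admissible S : set (topology G) :=
  [set t | hausdorff_group_topology t /\ S `<=` convergent_to_unit t].

Definition Ts_set S := exists t, admissible S t.

Definition T_sequence u := Ts_set [set u].

Definition is_Ts_topology S : set (topology G) :=
  [set t | admissible S t /\ forall t', admissible S t' -> finer t t'].

(* Only meaningful when S is a Ts_set, see Ts_topologyP below; the value is
   discrete otherwise. *)
Definition Ts_topology S : topology G := xget (discrete G) (is_Ts_topology S).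

Definition T_topology u : topology G := Ts_topology [set u].

Definition s_group t :=
  hausdorff_group_topology t /\ exists S, Ts_set S /\ t = Ts_topology S.

End topologies_on_groups.

Section Ts_topology_exists.
Variables (G : groupType) (S : set (nat -> G)).

Let J := {t : topology G | admissible S t}.
Let Tc (j : J) : Topological G := Topological.class (space (projT1 j)).
Let supT : topologicalType := sup_topology Tc.
Let supt : topology G :=
  @Topology G (open : set_system supT) openT (@openI supT)
    (fun K f fo => @bigcup_open supT K setT f (fun j _ => fo j)).

Let nbhs_supt (x : G) : nbhs (x : space supt) = nbhs (x : supT).
Proof. by rewrite (@nbhsE supT); apply/seteqP; split=> A /= [B []]; exists B. Qed.

Let cvg_supt (F : set_system G) (x : G) : Filter F ->
  (forall t, admissible S t -> F --> (x : space t)) -> F --> (x : space supt).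
Proof.
move=> FF cF; rewrite nbhs_supt.
by apply/(@cvg_sup G J Tc F x FF) => -[t St]; exact: cF.
Qed.

Let supt_finer t : admissible S t -> finer supt t.
Proof.
move=> St A tA; rewrite /= openE => x Ax.
have /(@cvg_sup G J Tc _ x _) : nbhs (x : supT) --> (x : supT) by [].
move=> /(_ (exist _ t St)); apply.
exact: (@open_nbhs_nbhs (space t)).
Qed.

Let finer_nbhs (s t : topology G) (x : G) : finer s t ->
  nbhs (x : space s) --> (x : space t).
Proof. by move=> st A [B [oB Bx BA]]; exists B; split=> //; exact: st. Qed.

Lemma Ts_topologyP : Ts_set S -> is_Ts_topology S (Ts_topology S).
Proof.
move=> [t0 St0]; apply: xgetPex; exists supt; split; last exact: supt_finer.
split; last first.
  move=> u Su; apply: cvg_supt => t [_]; exact.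
split; first split.
- move=> -[x y]; apply: cvg_supt => t St.
  have [[[/(_ (x, y)) mt _] _] _] := St.
  apply: cvg_trans mt => A [[P Q] [/= Px Qy] PQA].
  exists (P, Q); last exact: PQA.
  by split; apply: (finer_nbhs (supt_finer St)).
- move=> x; apply: cvg_supt => [|t St]; first by apply: fmap_filter; exact: (@nbhs_filter (space supt)).
  have [[[_ /(_ x) it] _] _] := St.
  by apply: cvg_trans it => A /= /(finer_nbhs (supt_finer St)).
- have [[_ h] _] := St0.
  move=> x y xy; apply: h => A B xA yB.
  by apply: xy; apply: (finer_nbhs (supt_finer St0)).
Qed.

End Ts_topology_exists.

(* Main.v *)
(** Every [u] converging to the unit in [tau] gives
    [tau `<=` tau_S `<=` tau_u], by the universal properties of [tau_S] and
    [tau_u]. Conversely, a set [A] open in all the [tau_u] is sequentially open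
    in [tau]: if [v n --> x] with [x] in [A], then [u n := x^-1 * v n] converges
    to the unit, so [v n = x * u n] converges to [x] in [tau_u] and is
    eventually in [A]. *)
Require Import Defs.
From mathcomp Require Import all_boot all_classical topology.

Set Implicit Arguments.
Unset Strict Implicit.
Unset Printing Implicit Defensive.

Local Open Scope classical_set_scope.

(** Joint continuity of the product at [(a, x)], applied to the pairs [(a, u n)]. *)
Lemma cvg_mulgl (G : groupType) (t : topology G) (a x : G) (u : nat -> G) :
  group_topology t -> u @ \oo --> (x : space t) ->
  (fun n => a * u n)%g @ \oo --> ((a * x)%g : space t).
Proof.
move=> [mt _] ux.
have h : (fun n => (a, u n) : space t * space t) @ \oo -->
    ((a, x) : space t * space t).
  exact: (@cvg_pair _ (space t) (space t) _ (nbhs (a : space t))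
    (nbhs (x : space t)) _ _ _ _ _ (@cvg_cst (space t) a _ _ _) ux).
exact: (cvg_comp _ _ h (mt (a, x))).
Qed.

Section topologies_from_sequences.
Variable G : groupType.
Implicit Types (t : topology G) (u : nat -> G) (S : set (nat -> G)).

Lemma admissibleS S S' t : S `<=` S' -> admissible S' t -> admissible S t.
Proof. by move=> SS' [ht cS']; split=> // u /SS'; exact: cS'. Qed.

Lemma admissible_convergent_to_unit t :
  hausdorff_group_topology t -> admissible (convergent_to_unit t) t.
Proof. by split. Qed.

Lemma admissible_Ts_topology S : Ts_set S -> admissible S (Ts_topology S).
Proof. by case/Ts_topologyP. Qed.

Lemma finer_Ts_topology S t : admissible S t -> finer (Ts_topology S) t.
Proof. by move=> St; have [|_] := @Ts_topologyP G S; [exists t|exact]. Qed.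

(** More sequences leave fewer admissible topologies: [Ts_topology S'] is itself admissible for
    [S]. *)
Lemma finer_Ts_topologyS S S' :
  Ts_set S' -> S `<=` S' -> finer (Ts_topology S) (Ts_topology S').
Proof.
by move=> /admissible_Ts_topology S't SS'; apply: finer_Ts_topology;
  exact: admissibleS S't.
Qed.

Lemma finer_meet_T_topology t :
  hausdorff_group_topology t -> sequential_space (space t) ->
  finer t (meet_topology (convergent_to_unit t) (@T_topology G)).
Proof.
move=> ht seqt A oA; apply/(seqt A) => v x Ax vx.
pose u n := (x^-1 * v n)%g.
have u1 : convergent_to_unit t u.
  by have := cvg_mulgl (a := x^-1%g) ht.1 vx; rewrite mulVg.
(* [t] witnesses that [[set u]] is a [Ts_set], so [T_topology u] is not merely the default value of
   [xget]. *)
have [[gu _] /(_ u erefl) cu] : admissible [set u] (T_topology u).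
  apply: admissible_Ts_topology; exists t.
  by apply: (admissibleS _ (admissible_convergent_to_unit ht)) => _ ->.
(* The translation back to [x] takes place in [T_topology u], where [A] is open by [oA]. *)
have := cvg_mulgl (a := x) gu cu; rewrite mulg1 => /(_ A) vA.
have : \forall n \near \oo, A (x * u n)%g.
  by apply: vA; apply: (@open_nbhs_nbhs (space (T_topology u))); split=> //;
    exact: oA.
by apply: filterS => n; rewrite /u mulVKg.
Qed.

End topologies_from_sequences.

Theorem theorem1p14 (G : groupType) (tau : topology G)
    (tau_hausdorff_group : hausdorff_group_topology tau)
    (tau_sequential : sequential_space (space tau)) :
  s_group tau /\
  tau = Ts_topology (convergent_to_unit tau) /\
  Ts_topology (convergent_to_unit tau) =
    meet_topology (convergent_to_unit tau) (@T_topology G).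
Proof.
set S := convergent_to_unit tau; set m := meet_topology S _.
have Stau : admissible S tau by exact: admissible_convergent_to_unit.
have SP : Ts_set S by exists tau.
have tau_S : opens tau `<=` opens (Ts_topology S) by exact: finer_Ts_topology.
have S_m : opens (Ts_topology S) `<=` opens m.
  move=> A oA; rewrite /m /= => u Su.
  by apply: (finer_Ts_topologyS SP _ oA) => _ ->.
have m_tau : opens m `<=` opens tau by exact: finer_meet_T_topology.
(* The inclusions [tau_S], [S_m] and [m_tau] form a cycle, so the three topologies coincide. *)
have tauE : tau = Ts_topology S.
  apply/topology_eq/seteqP; split; first exact: tau_S.
  exact: (subset_trans S_m m_tau).
split; first by split=> //; exists S.
split; first by [].
apply/topology_eq/seteqP; split; first exact: S_m.
exact: (subset_trans m_tau tau_S).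
Qed.
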